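(* Let $X_1,X_2,\ldots$ be a sequence in a Hilbert space $H$ which is either weakly stationary, or of the form $X_i=T^iX_0$ $(i\ge1)$ with $T$ a linear contraction of $H$ and $X_0\in H$. Let $S_n=X_1+\cdots+X_n$. Then $$\lim_{n\to\infty}\left\|\frac{S_n}{n}\right\|=\inf_{n\ge1}\left\|\frac{S_n}{n}\right\|.$$
   Context: A sequence $X_1,X_2,\ldots$ in a Hilbert space $H$ is weakly stationary if $\langle X_{i+k},X_{j+k}\rangle=\langle X_i,X_j\rangle$ for all $i,j\ge1$ and $k\ge 0$. A contraction is a linear operator $T$ with $\|Tg\|\le\|g\|$ for all $g\in H$. *)

(* Defs.v *)
From HB Require Import structures.
From mathcomp Require Import all_boot all_order all_algebra.
From mathcomp Require Import sesquilinear complex.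
From mathcomp Require Import all_classical all_reals all_analysis.
Set Implicit Arguments.
Unset Strict Implicit.
Unset Printing Implicit Defensive.
Import Order.TTheory GRing.Theory Num.Theory.
Import numFieldNormedType.Exports.
Local Open Scope classical_set_scope.
Local Open Scope ring_scope.

(* A Hilbert space over K is a Banach space over K whose norm comes from an
   inner product; the form is linear on the left and theta-semilinear on the
   right.  Real Hilbert spaces are the case K = R, theta = idfun, and complex
   ones the case K = R[i], theta = complex conjugation.  Norms are K-valued: over
   R[i] they are complex numbers with zero imaginary part, and complex.Re gives
   the corresponding real number. *)
HB.mixin Record CompleteNormedModule_isHilbert (K : numFieldType)
    (theta : K -> K) H of CompleteNormedModule K H := {
  inner : {dot H for theta};
  sqr_normE : forall x : H, `|x| ^+ 2 = inner x x
}.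

#[short(type="hilbertType")]
HB.structure Definition Hilbert (K : numFieldType) (theta : K -> K) :=
  {H of CompleteNormedModule K H & CompleteNormedModule_isHilbert K theta H}.

(* The sequences below are indexed from 1: the value X 0 is never used. *)

Definition weakly_stationary (K : numFieldType) (theta : K -> K)
    (H : hilbertType theta) (X : nat -> H) : Prop :=
  forall i j k : nat, (1 <= i)%N -> (1 <= j)%N ->
    inner (X (i + k)%N) (X (j + k)%N) = inner (X i) (X j).

Definition contraction (K : numFieldType) (theta : K -> K)
    (H : hilbertType theta) (T : {linear H -> H}) : Prop :=
  forall g : H, `|T g| <= `|g|.

Definition contraction_orbit (K : numFieldType) (theta : K -> K)
    (H : hilbertType theta) (X : nat -> H) : Prop :=
  exists (T : {linear H -> H}) (X0 : H),
    contraction T /\ forall i : nat, (1 <= i)%N -> X i = iter i T X0.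

Definition average (K : numFieldType) (theta : K -> K)
    (H : hilbertType theta) (X : nat -> H) (n : nat) : H :=
  n%:R^-1 *: \sum_(1 <= i < n.+1) X i.

(* Main.v *)
Require Import Defs.
From HB Require Import structures.
From mathcomp Require Import all_boot all_order all_algebra.
From mathcomp Require Import sesquilinear complex.
From mathcomp Require Import ring lra.
From mathcomp Require Import all_classical all_reals all_analysis.
Set Implicit Arguments.
Unset Strict Implicit.
Unset Printing Implicit Defensive.
Import Order.TTheory GRing.Theory Num.Theory.
Import numFieldNormedType.Exports.
Local Open Scope classical_set_scope.
Local Open Scope ring_scope.

(** Both hypotheses bound every shifted block [X (k+1) + ... + X (k+n)] by [S_n] in
    norm, so the norms of the [S_n] are subadditive and the statement is an
    instance of Fekete's lemma. *)

(** Stationarity makes the Gram matrix of a block shift-invariant, so shifting preserves the norm of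
    its sum; for an orbit, shifting by one applies [T], which cannot increase it. With the triangle
    inequality this gives [norm_sum_subadditive], and [fekete] turns subadditivity into convergence
    of the averages to their infimum. *)

Lemma subadditive_mulD (R : numDomainType) (a : nat -> R) :
  (forall m n, a (m + n)%N <= a m + a n) ->
  forall q m r, a (q * m + r)%N <= a m *+ q + a r.
Proof.
move=> a_sub q m r; elim: q => [|q IHq]; first by rewrite mul0n mulr0n add0r.
rewrite mulSn -addnA mulrS -addrA (le_trans (a_sub _ _))//.
by rewrite lerD2l.
Qed.

(** Divide [n] by [m]: the quotient supplies the slope, while [C] absorbs the remainder, which takes
    only [m] values. *)
Lemma subadditive_le_linear (R : realFieldType) (a : nat -> R) (m : nat) :
  (forall n p, a (n + p)%N <= a n + a p) -> (0 < m)%N ->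
  exists C : R, forall n, a n <= a m / m%:R * n%:R + C.
Proof.
move=> a_sub m0; exists (\sum_(i < m) `|a i| + `|a m|) => n.
have m0' : (0 : R) < m%:R by rewrite ltr0n.
rewrite {1}(divn_eq n m) (le_trans (subadditive_mulD a_sub _ _ _))//.
have -> : a m / m%:R * n%:R = a m *+ (n %/ m) + a m * ((n %% m)%:R / m%:R).
  rewrite {1}(divn_eq n m) natrD natrM -[a m *+ _]mulr_natr.
  by field; rewrite lt0r_neq0.
rewrite -addrA lerD2l.
have ar : a (n %% m)%N <= \sum_(i < m) `|a i|.
  rewrite (bigD1 (Ordinal (ltn_pmod n m0)))//= (le_trans (ler_norm _))//.
  by rewrite ler_wpDr// sumr_ge0.
have : `|a m * ((n %% m)%:R / m%:R)| <= `|a m|.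
  rewrite normrM ler_piMr// ger0_norm ?divr_ge0//.
  by rewrite ler_pdivrMr// mul1r ler_nat ltnW// ltn_pmod.
by rewrite ler_norml => /andP[am _]; lra.
Qed.

Lemma fekete (R : realType) (a : nat -> R) :
  (forall m n, a (m + n)%N <= a m + a n) ->
  has_lbound [set a n / n%:R | n in [set n | (1 <= n)%N]] ->
  (fun n => a n / n%:R) @ \oo -->
    inf [set a n / n%:R | n in [set n | (1 <= n)%N]].
Proof.
set E := [set _ | _ in _] => a_sub E_lb.
have E_inf : has_inf E by split => //; exists (a 1%N / 1%:R); exists 1%N.
apply/cvgrPdist_lt => e e0.
have e20 : 0 < e / 2 by rewrite divr_gt0.
have [_ [m /= m0 <-] am] := inf_adherent e20 E_inf.
have [C aC] := subadditive_le_linear a_sub m0.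
near=> n.
have n0 : (0 < n)%N by near: n; exact: nbhs_infty_gt.
have n0' : (0 : R) < n%:R by rewrite ltr0n.
rewrite distrC ger0_norm ?subr_ge0; last by apply: ge_inf => //; exists n.
rewrite ltrBlDl ltr_pdivrMr// (le_lt_trans (aC n))//.
have Cn : C < e / 2 * n%:R.
  rewrite mulrC -ltr_pdivrMr//; near: n; exact: nbhs_infty_gtr.
have : a m / m%:R * n%:R < (inf E + e / 2) * n%:R by rewrite ltr_pM2r.
rewrite mulrDl mulrDl; lra.
Unshelve. all: by end_near.
Qed.

Lemma ler_norm_sumD (K : numDomainType) (V : normedZmodType K) (X : nat -> V) :
  (forall k n, `|\sum_(1 <= i < n.+1) X (i + k)%N| <= `|\sum_(1 <= i < n.+1) X i|) ->
  forall m n, `|\sum_(1 <= i < (m + n).+1) X i| <=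
    `|\sum_(1 <= i < m.+1) X i| + `|\sum_(1 <= i < n.+1) X i|.
Proof.
move=> Xk m n; rewrite (@big_cat_nat _ _ _ m.+1)//= ?ltnS ?leq_addr//.
rewrite (le_trans (ler_normD _ _))// lerD2l.
(* The tail from [m + 1] to [m + n] is the first block of length [n] shifted by [m]. *)
by rewrite -[m.+1]add1n big_addn -addnS addKn.
Qed.

(** The squared norm expands into a double sum of inner products, each invariant under the shift. *)
Lemma weakly_stationary_norm_sum_shift (K : numFieldType) (theta : K -> K)
    (H : hilbertType theta) (X : nat -> H) (k n : nat) :
  weakly_stationary X ->
  `|\sum_(1 <= i < n.+1) X (i + k)%N| = `|\sum_(1 <= i < n.+1) X i|.
Proof.
move=> Xst; apply/eqP; rewrite -(@eqrXn2 _ 2)// !sqr_normE; apply/eqP.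
rewrite !linear_sumlz; apply: eq_big_nat => i /andP[i1 _].
rewrite !linear_sumr; apply: eq_big_nat => j /andP[j1 _].
exact: Xst.
Qed.

(** Induction on [k]: by linearity, the sum shifted by [k + 1] is [T] of the sum shifted by [k]. *)
Lemma contraction_orbit_norm_sum_shift (K : numFieldType) (theta : K -> K)
    (H : hilbertType theta) (X : nat -> H) (k n : nat) :
  contraction_orbit X ->
  `|\sum_(1 <= i < n.+1) X (i + k)%N| <= `|\sum_(1 <= i < n.+1) X i|.
Proof.
case=> T [X0 [Tle XE]]; elim: k => [|k IHk].
  by under eq_bigr do rewrite addn0.
apply: le_trans IHk; apply: le_trans (Tle _).
rewrite linear_sum (eq_big_nat _ _ (F2 := fun i => T (X (i + k)%N)))//.
by move=> i /andP[i1 _]; rewrite !XE ?addnS ?ltn_addr// iterS.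
Qed.

Lemma norm_sum_subadditive (K : numFieldType) (theta : K -> K)
    (H : hilbertType theta) (X : nat -> H) :
  weakly_stationary X \/ contraction_orbit X ->
  forall m n, `|\sum_(1 <= i < (m + n).+1) X i| <=
    `|\sum_(1 <= i < m.+1) X i| + `|\sum_(1 <= i < n.+1) X i|.
Proof.
move=> HX; apply: ler_norm_sumD => k n; case: HX => [Xst|Xco].
  by rewrite weakly_stationary_norm_sum_shift.
exact: contraction_orbit_norm_sum_shift.
Qed.

(** This includes [n = 0], where both sides vanish, so it can be used as an equality of
    functions. *)
Lemma norm_average (K : numFieldType) (theta : K -> K)
    (H : hilbertType theta) (X : nat -> H) (n : nat) :
  `|average X n| = `|\sum_(1 <= i < n.+1) X i| / n%:R.
Proof. by rewrite normrZ mulrC ger0_norm// invr_ge0. Qed.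

Lemma Re_div_nat (R : rcfType) (z : R[i]) (n : nat) :
  complex.Re (z / n%:R) = complex.Re z / n%:R.
Proof.
rewrite -[n%:R in LHS](rmorph_nat (real_complex R)) -fmorphV.
by case: z => x y; rewrite /= mulr0 subr0.
Qed.

Theorem mainTheorem4 (R : realType) :
  (forall (H : hilbertType (@idfun R)) (X : nat -> H),
     weakly_stationary X \/ contraction_orbit X ->
     (fun n : nat => `|average X n|) @ \oo -->
       inf [set `|average X n| | n in [set n : nat | (1 <= n)%N]])
  /\
  (forall (H : hilbertType (@Num.conj R[i])) (X : nat -> H),
     weakly_stationary X \/ contraction_orbit X ->
     (fun n : nat => complex.Re `|average X n|) @ \oo -->
       inf [set complex.Re `|average X n| | n in [set n : nat | (1 <= n)%N]]).
Proof.
split=> H X HX; have S_sub := norm_sum_subadditive HX.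
- rewrite (funext (norm_average X)); apply: fekete => //.
  by exists 0 => _ [n _ <-]; rewrite divr_ge0.
- have -> : (fun n => complex.Re `|average X n|) =
      (fun n => complex.Re `|\sum_(1 <= i < n.+1) X i| / n%:R).
    by apply/funext => n; rewrite norm_average Re_div_nat.
  apply: (fekete (a := fun n => complex.Re `|\sum_(1 <= i < n.+1) X i|)).
    (* The order on [R[i]] compares real parts and requires equal imaginary parts, so subadditivity
       passes to real parts. *)
    move=> m n; have := S_sub m n; rewrite lecE => /andP[_].
    by case: `|\sum_(1 <= i < m.+1) _| `|\sum_(1 <= i < n.+1) _| => [? ?] [? ?].
  exists 0 => _ [n _ <-]; rewrite divr_ge0//.
  by have := normr_ge0 (\sum_(1 <= i < n.+1) X i); rewrite lecE => /andP[].
Qed.
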